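(* Let $\mathbb{K}$ be a field and let $\mathbf{d}=(d_p,\dots,d_1)$ be any sequence of positive integers. There exists a simplicial complex $\Delta$ (on some finite vertex set) such that the Betti diagram $\beta(I_\Delta)$ of its Stanley-Reisner ideal over $\mathbb{K}$ is pure with degree type $\mathbf{d}$.
   Context: A simplicial complex $\Delta$ on a finite vertex set $V$ is a set of subsets of $V$ closed under taking subsets. If $V$ is identified with $\{1,\dots,n\}$ and $R=\mathbb{K}[x_1,\dots,x_n]$ (standard graded), the Stanley-Reisner ideal is $I_\Delta=\langle\prod_{i\in\sigma}x_i:\sigma\subseteq V,\sigma\notin\Delta\rangle\subseteq R$. The graded Betti numbers $\beta_{i,d}(I_\Delta)$ are the exponents in the minimal graded free resolution of $I_\Delta$ as an $R$-module. The Betti diagram $\beta(I_\Delta)$ is pure if for every $i$ there is at most one $c$ with $\beta_{i,c}(I_\Delta)\neq0$. In that case the minimal graded free resolution has the form $$0\to R(-c_p)^{\beta_{p,c_p}}\to\dots\to R(-c_1)^{\beta_{1,c_1}}\to R(-c_0)^{\beta_{0,c_0}}\to I_\Delta\to0$$ with all $\beta_{i,c_i}\ne0$ for $0\le i\le p$, and its degree type is the sequence $(c_p-c_{p-1},\dots,c_1-c_0)$. *)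

(* Defs.v *)
From HB Require Import structures.
From mathcomp Require Import all_boot all_order all_algebra.
From mathcomp Require Import mpoly.

Set Implicit Arguments.
Unset Strict Implicit.
Unset Printing Implicit Defensive.

Import GRing.Theory.
Local Open Scope ring_scope.

(* The void complex (no faces at all) is allowed; its ideal is the unit ideal. *)
Definition simplicial_complex (n : nat) (Delta : {set {set 'I_n}}) : Prop :=
  forall s t : {set 'I_n}, s \in Delta -> t \subset s -> t \in Delta.

Definition stanley_reisner (K : fieldType) (n : nat) (Delta : {set {set 'I_n}})
    (f : {mpoly K[n]}) : Prop :=
  exists q : {set 'I_n} -> {mpoly K[n]},
    f = \sum_(s : {set 'I_n} | s \notin Delta) q s * \prod_(i in s) 'X_i.

(* The data of an augmented sequence of finitely generated graded free modules
     ... -> F_2 -> F_1 -> F_0 -> R,   R = K[x_1, ..., x_n].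
   F_i has a basis indexed by 'I_(fr_rank i), whose element a has degree
   fr_deg a: F_i is the direct sum of the R(- fr_deg a).  Elements of F_i are
   row vectors, and matrices act on them on the right. *)
Record free_sequence (K : fieldType) (n : nat) := FreeSequence {
  fr_rank : nat -> nat;
  fr_deg : forall i : nat, 'I_(fr_rank i) -> nat;
  fr_diff : forall i : nat, 'M[{mpoly K[n]}]_(fr_rank i.+1, fr_rank i);
  fr_aug : 'cV[{mpoly K[n]}]_(fr_rank 0)
}.

(* All maps preserve degrees: a nonzero entry from a generator of degree t to
   one of degree s is homogeneous of degree t - s, with s <= t. *)
Definition fr_graded (K : fieldType) (n : nat) (F : free_sequence K n) : Prop :=
  (forall a : 'I_(fr_rank F 0), fr_aug F a 0 \is (fr_deg a).-homog) /\
  (forall (i : nat) (a : 'I_(fr_rank F i.+1)) (b : 'I_(fr_rank F i)),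
     fr_diff F i a b != 0 ->
     (fr_deg b <= fr_deg a)%N /\
     fr_diff F i a b \is (fr_deg a - fr_deg b)%N.-homog).

(* Exactness of ... -> F_1 -> F_0 -> I -> 0. *)
Definition fr_resolves (K : fieldType) (n : nat) (F : free_sequence K n)
    (I : {mpoly K[n]} -> Prop) : Prop :=
  [/\ forall f : {mpoly K[n]},
        I f <-> exists v : 'rV_(fr_rank F 0), v *m fr_aug F = f%:M,
      forall v : 'rV_(fr_rank F 0),
        v *m fr_aug F = 0 <-> exists w, w *m fr_diff F 0 = v
    & forall (i : nat) (v : 'rV_(fr_rank F i.+1)),
        v *m fr_diff F i = 0 <-> exists w, w *m fr_diff F i.+1 = v].

(* F_{i+1} is mapped into <x_1, ..., x_n> F_i: constant terms vanish. *)
Definition fr_minimal (K : fieldType) (n : nat) (F : free_sequence K n) : Prop :=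
  forall (i : nat) (a : 'I_(fr_rank F i.+1)) (b : 'I_(fr_rank F i)),
    (fr_diff F i a b)@_0%MM = 0.

Definition minimal_graded_free_resolution (K : fieldType) (n : nat)
    (F : free_sequence K n) (I : {mpoly K[n]} -> Prop) : Prop :=
  [/\ fr_graded F, fr_resolves F I & fr_minimal F].

(* beta i c is the exponent of R(-c) in the i-th module of the minimal graded
   free resolution of I.  As the latter is unique up to isomorphism, at most one
   beta satisfies this. *)
Definition betti_diagram (K : fieldType) (n : nat) (I : {mpoly K[n]} -> Prop)
    (beta : nat -> nat -> nat) : Prop :=
  exists2 F : free_sequence K n,
    minimal_graded_free_resolution F I &
    forall i c : nat, beta i c = #|[set a : 'I_(fr_rank F i) | fr_deg a == c]|.

Definition pure_diagram (beta : nat -> nat -> nat) : Prop :=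
  forall i c c' : nat, beta i c <> 0%N -> beta i c' <> 0%N -> c = c'.

(* The list is (c_p - c_{p-1}, ..., c_1 - c_0), highest index first.  The shifts
   of a minimal resolution increase strictly, so the subtractions on nat do not
   truncate. *)
Definition has_degree_type (beta : nat -> nat -> nat) (d : seq nat) : Prop :=
  exists (p : nat) (c : nat -> nat),
    [/\ forall i : nat, (i <= p)%N -> beta i (c i) <> 0%N,
        forall i j : nat, (p < i)%N -> beta i j = 0%N
      & d = rev (mkseq (fun i => (c i.+1 - c i)%N) p)].

(* Main.v *)
From HB Require Import structures.
Require Import Defs.
From mathcomp Require Import all_boot all_order all_algebra.
From mathcomp Require Import mpoly.
From mathcomp Require Import zify ring.

(* A complex over K whose basis cells carry squarefree monomial labels gives a
   minimal free resolution as soon as its restriction to the cells with label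
   dividing any given monomial is acyclic or empty, and labels grow strictly along
   the boundary.  The full simplex on p + 1 vertices, labelled by its own faces,
   has degree type (1, ..., 1).

   Suppose the labels of the cells of dimension < i grow by one degree per
   dimension.  For each such cell f take a new variable y_f, and replace every
   such cell h by the copies (h, f), h <= f, labelled by lab h and all new
   variables but y_f, and by the prisms [h, f], h < f, of dimension dim h + 1,
   which join (h, h) to (h, f) and are labelled by lab h and all new variables;
   the cells of dimension >= i receive all new variables.  If a monomial misses no
   new variable, the part below it retracts by deformation onto the old complex; if
   it misses y_f only, this part is a copy of the closed cell f; otherwise it is
   empty.  So acyclicity is kept, and the step raises d_i = c_i - c_(i-1) by one
   and changes no other difference.  Doing this first for i = p, then for p - 1,
   and so on down to 1, reaches every sequence of positive integers. *)
Set Implicit Arguments.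
Unset Strict Implicit.
Unset Printing Implicit Defensive.
Import GRing.Theory.
Local Open Scope ring_scope.

(** * Based chain complexes and homotopy transfer of exactness *)

Section Chains.
Variable K : fieldType.

(** The codomain is [K^o] so that chains inherit a [K]-module structure. *)
Definition chain (B : finType) := {ffun B -> K^o}.

Definition face (B : finType) (b : B) : chain B := [ffun x => (x == b)%:R].

Definition ext (B B' : finType) (phi : B -> chain B') (z : chain B) : chain B' :=
  \sum_b z b *: phi b.

Definition aug (B : finType) (dm : B -> nat) (z : chain B) : K :=
  \sum_b z b * (dm b == 0)%:R.

Lemma ext_is_linear (B B' : finType) (phi : B -> chain B') : linear (ext phi).
Proof.
move=> a u v; rewrite /ext scaler_sumr -big_split; apply: eq_bigr => b _ /=.
by rewrite !ffunE scalerDl scalerA.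
Qed.
HB.instance Definition _ (B B' : finType) (phi : B -> chain B') :=
  GRing.isLinear.Build K (chain B) (chain B') _ (ext phi) (ext_is_linear phi).

Lemma aug_is_linear (B : finType) (dm : B -> nat) : scalar (@aug B dm).
Proof.
move=> a u v; rewrite /aug mulr_sumr -big_split; apply: eq_bigr => b _ /=.
by rewrite !ffunE mulrDl -mulrA.
Qed.
HB.instance Definition _ (B : finType) (dm : B -> nat) :=
  GRing.isLinear.Build K (chain B) K _ (aug dm) (aug_is_linear dm).

Lemma ext_face (B B' : finType) (phi : B -> chain B') b : ext phi (face b) = phi b.
Proof.
rewrite /ext (bigD1 b) //= big1 ?addr0 ?ffunE ?eqxx ?scale1r // => x nx.
by rewrite ffunE (negbTE nx) scale0r.
Qed.

Lemma aug_face (B : finType) (dm : B -> nat) b : aug dm (face b) = (dm b == 0)%:R.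
Proof.
rewrite /aug (bigD1 b) //= big1 ?addr0 ?ffunE ?eqxx ?mul1r // => x nx.
by rewrite ffunE (negbTE nx) mul0r.
Qed.

Lemma ext_id (B : finType) (z : chain B) : ext (@face B) z = z.
Proof.
apply/ffunP=> x; rewrite /ext sum_ffunE (bigD1 x) //= big1 => [|y ny].
  by rewrite !ffunE eqxx addr0 /GRing.scale /= mulr1.
by rewrite !ffunE eq_sym (negbTE ny) /GRing.scale /= mulr0.
Qed.

Lemma ext_comp (B B' B'' : finType) (phi : B' -> chain B'') (psi : B -> chain B') z :
  ext phi (ext psi z) = ext (fun b => ext phi (psi b)) z.
Proof. by rewrite {2}/ext linear_sum; apply: eq_bigr => b _; rewrite linearZ. Qed.

Lemma extDf (B B' : finType) (phi psi : B -> chain B') z :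
  ext (fun b => phi b + psi b) z = ext phi z + ext psi z.
Proof. by rewrite -big_split; apply: eq_bigr => b _; rewrite scalerDr. Qed.

Lemma extNf (B B' : finType) (phi : B -> chain B') z :
  ext (fun b => - phi b) z = - ext phi z.
Proof. by rewrite -sumrN; apply: eq_bigr => b _; rewrite scalerN. Qed.

Lemma ext0f (B B' : finType) z : ext (fun _ : B => 0 : chain B') z = 0.
Proof. by rewrite /ext big1 // => b _; rewrite scaler0. Qed.

Definition on (B : finType) (A : {pred B}) (z : chain B) := forall b, z b != 0 -> b \in A.

Lemma on0 (B : finType) (A : {pred B}) : on A 0.
Proof. by move=> b; rewrite ffunE eqxx. Qed.

Lemma onD (B : finType) (A : {pred B}) u v : on A u -> on A v -> on A (u + v).
Proof.
move=> Au Av b; rewrite ffunE; have [->|/Au //] := eqVneq (u b) 0.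
by rewrite add0r => /Av.
Qed.

Lemma onN (B : finType) (A : {pred B}) u : on A u -> on A (- u).
Proof. by move=> Au b; rewrite ffunE oppr_eq0 => /Au. Qed.

Lemma onZ (B : finType) (A : {pred B}) a u : on A u -> on A (a *: u).
Proof. by move=> Au b; rewrite ffunE mulf_eq0 negb_or => /andP[_ /Au]. Qed.

Lemma on_face (B : finType) (A : {pred B}) b : b \in A -> on A (face b).
Proof. by move=> Ab x; rewrite ffunE; case: (eqVneq x b) => [->|_] //; rewrite eqxx. Qed.

Lemma on_sub (B : finType) (A A' : {pred B}) z : {subset A <= A'} -> on A z -> on A' z.
Proof. by move=> sA Az b /Az /sA. Qed.

Lemma on_ext (B B' : finType) (A : {pred B}) (A' : {pred B'}) phi z :
  on A z -> (forall b, b \in A -> on A' (phi b)) -> on A' (ext phi z).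
Proof.
move=> Az Aphi; rewrite /ext; elim/big_rec: _ => [|b u _ Au]; first exact: on0.
apply: onD => //; have [->|/Az /Aphi] := eqVneq (z b) 0; last exact: onZ.
by rewrite scale0r; apply: on0.
Qed.

Lemma eq_ext_on (B B' : finType) (A : {pred B}) (phi psi : B -> chain B') z :
  on A z -> (forall b, b \in A -> phi b = psi b) -> ext phi z = ext psi z.
Proof.
move=> Az ee; apply: eq_bigr => b _.
by have [->|/Az /ee ->] := eqVneq (z b) 0; rewrite ?scale0r.
Qed.

Lemma ext0_on (B B' : finType) (A : {pred B}) (phi : B -> chain B') z :
  on A z -> (forall b, b \in A -> phi b = 0) -> ext phi z = 0.
Proof. by move=> Az h; rewrite (eq_ext_on (psi := fun=> 0) Az h) ext0f. Qed.

Lemma aug_ext (B B' : finType) (A : {pred B}) (dm : B -> nat) (dm' : B' -> nat) phi z :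
  on A z -> (forall b, b \in A -> aug dm' (phi b) = (dm b == 0)%:R) ->
  aug dm' (ext phi z) = aug dm z.
Proof.
move=> Az h; rewrite linear_sum; apply: eq_bigr => b _; rewrite linearZ /=.
by have [->|/Az /h ->] := eqVneq (z b) 0; rewrite ?mul0r.
Qed.

(** Vanishing reduced homology of the subcomplex on [A]. Chains need not be homogeneous, so the
    first clause treats all dimensions at once; the second makes the augmentation surjective. *)
Definition exact_on (B : finType) (bd : B -> chain B) (dm : B -> nat) (A : {pred B}) :=
  (forall z, on A z -> ext bd z = 0 -> aug dm z = 0 -> exists2 w, on A w & ext bd w = z) /\
  (exists2 w, on A w & aug dm w = 1).

Lemma eq_exact_on (B : finType) (bd : B -> chain B) dm (A A' : {pred B}) :
  A =i A' -> exact_on bd dm A -> exact_on bd dm A'.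
Proof.
move=> eA [ex [w Aw w1]]; have onE z : on A z <-> on A' z by split=> h x /h; rewrite eA.
split; last by exists w => //; apply/onE.
by move=> z /onE Az bz az; have [u Au bu] := ex z Az bz az; exists u => //; apply/onE.
Qed.

(** If [z] is a cycle on [A'], then [r z] is a cycle on [A], say the boundary of [w]; the homotopy
    identity applied to [z] shows that [s w + H z] has boundary [z]. *)
Lemma exact_transfer (B B' : finType) (bd : B -> chain B) (bd' : B' -> chain B')
    (dm : B -> nat) (dm' : B' -> nat) (A : {pred B}) (A' : {pred B'})
    (s : B -> chain B') (r : B' -> chain B) (H : B' -> chain B') :
    (forall b, b \in A -> on A' (s b)) ->
    (forall b, b \in A' -> on A (r b)) ->
    (forall b, b \in A' -> on A' (H b)) ->
    (forall b, b \in A -> ext bd' (s b) = ext s (bd b)) ->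
    (forall b, b \in A' -> ext bd (r b) = ext r (bd' b)) ->
    (forall b, b \in A -> aug dm' (s b) = (dm b == 0)%:R) ->
    (forall b, b \in A' -> aug dm (r b) = (dm' b == 0)%:R) ->
    (forall b, b \in A' -> face b = ext s (r b) + ext bd' (H b) + ext H (bd' b)) ->
  exact_on bd dm A -> exact_on bd' dm' A'.
Proof.
move=> As Ar AH cs cr as_ ar hom [ex [w0 Aw0 w01]]; split=> [z Az bz az|]; last first.
  by exists (ext s w0); [apply: on_ext Aw0 As | rewrite (aug_ext Aw0 as_)].
have [|||w Aw bw] := ex (ext r z).
- exact: on_ext Az Ar.
- by rewrite ext_comp (eq_ext_on Az cr) -ext_comp bz linear0.
- by rewrite (aug_ext Az ar).
exists (ext s w + ext H z); first by apply: onD; [apply: on_ext Aw As | apply: on_ext Az AH].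
rewrite linearD /= ext_comp (eq_ext_on Aw cs) -ext_comp bw.
rewrite -[RHS]ext_id (eq_ext_on Az hom) !extDf -!ext_comp.
by rewrite bz linear0 addr0.
Qed.
End Chains.

(** * Labelled complexes and the stretching step *)

(* Only the cells in [live] belong to the complex. *)
Record labelled_complex (K : fieldType) := LabelledComplex {
  cell : finType;
  var : finType;
  live : {pred cell};
  dm : cell -> nat;
  lab : cell -> {set var};
  below : rel cell;
  bd : cell -> chain K cell
}.

Section Step.
Variable K : fieldType.
Local Notation labelled_complex := (labelled_complex K).
Local Notation face := (@face K _).

(** Labels are squarefree, so a label divides a monomial exactly when it lies in the set [W] of
    variables of that monomial; hence only sets are tested. *)
Definition supports_resolution (C : labelled_complex) (S : {pred cell C}) :=
  forall W : {set var C}, (exists2 b, b \in S & lab b \subset W) ->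
  exact_on (@bd K C) (@dm K C) [pred b | (b \in S) && (lab b \subset W)].

Definition down (C : labelled_complex) (f : cell C) : {pred cell C} := [pred b | below b f].

(** Compatibility with [below] is asked only under dimension [i], where down-sets have to be
    acyclic. *)
Definition facet_of (C : labelled_complex) (i : nat) (b : cell C) : {pred cell C} :=
  [pred y | [&& y \in @live K C, (dm y).+1 == dm b, lab y \subset lab b &
             (dm b < i)%N ==> below y b]].

(* [below] plays the role of the face order: the down-set of a cell of dimension
   less than [i] must again be acyclic. *)
Record resolution_complex (i p : nat) (c : nat -> nat) (C : labelled_complex) : Prop := ResolutionComplex {
  rc_bd : forall b, b \in @live K C -> on (facet_of i b) (bd b);
  rc_bdbd : forall b, b \in @live K C -> ext (@bd K C) (bd b) = 0;
  rc_aug : forall b, b \in @live K C -> aug (@dm K C) (bd b) = 0;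
  rc_live : forall x y : cell C, below x y -> (x \in @live K C) && (y \in @live K C);
  rc_refl : forall b, b \in @live K C -> below b b;
  rc_trans : transitive (@below K C);
  rc_lt : forall x y : cell C, below x y -> x != y -> (dm x < dm y)%N;
  rc_res : supports_resolution (@live K C);
  rc_down : forall f, f \in @live K C -> (dm f < i)%N -> supports_resolution (down f);
  rc_card : forall b, b \in @live K C -> #|lab b| = c (dm b);
  rc_le : forall b, b \in @live K C -> (dm b <= p)%N;
  rc_ex : forall j, (j <= p)%N -> exists2 b, b \in @live K C & dm b = j
}.

Variables (i p : nat) (c : nat -> nat) (C : labelled_complex).

Definition low : {set cell C} := [set f in @live K C | (dm f < i)%N].

(* [pt h f] is the copy (h, f), [seg h f] the prism [h, f], [old g] a cell of
   dimension at least [i]. *)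
Definition stretch_cell : finType := ((cell C * cell C) + (cell C * cell C) + cell C)%type.
Definition pt (h f : cell C) : stretch_cell := inl (inl (h, f)).
Definition seg (h f : cell C) : stretch_cell := inl (inr (h, f)).
Definition old (g : cell C) : stretch_cell := inr g.

(** For [h = f] the boundary formula of a prism gives zero: such a prism is degenerate and is left
    out. *)
Definition stretch_live : {pred stretch_cell} := fun x =>
  match x with
  | inl (inl (h, f)) => below h f && (f \in low)
  | inl (inr (h, f)) => [&& below h f, h != f & f \in low]
  | inr g => (g \in @live K C) && (i <= dm g)%N
  end.

Definition stretch_dm (x : stretch_cell) : nat :=
  match x with
  | inl (inl (h, _)) => dm h
  | inl (inr (h, _)) => (dm h).+1
  | inr g => dm g
  end.

Definition under (x : stretch_cell) : cell C :=
  match x with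
  | inl (inl (h, _)) => h
  | inl (inr (h, _)) => h
  | inr g => g
  end.

Definition new_vars (x : stretch_cell) : {set cell C} :=
  if x is inl (inl (_, f)) then low :\ f else low.

Definition stretch_lab (x : stretch_cell) : {set (var C + cell C)%type} :=
  inl @: lab (under x) :|: inr @: new_vars x.

(** The end of [[h, f]] at [h] is subdivided into cells indexed by faces [l] of [h], whence the
    alternative [below l h]; [l == f] gives the other end and the sides. Old cells have dimension at
    least [i], so equality suffices for them. *)
Definition stretch_below : rel stretch_cell := fun x y =>
  [&& x \in stretch_live, y \in stretch_live &
  match x, y with
  | inl (inl (k, l)), inl (inl (h, f)) => below k h && (l == f)
  | inl (inl (k, l)), inl (inr (h, f)) => below k h && ((l == f) || below l h)
  | inl (inr (k, l)), inl (inr (h, f)) => below k h && ((l == f) || below l h)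
  | inr g, inr g' => g == g'
  | _, _ => false
  end].

Definition Pt (f : cell C) : chain K (cell C) -> chain K stretch_cell :=
  ext (fun h => face (pt h f)).
Definition Seg (f : cell C) : chain K (cell C) -> chain K stretch_cell :=
  ext (fun h => face (seg h f)).
(** The subdivided cell [h]: its own copy [(h, h)] in the middle, surrounded by the prisms [[k, h]]
    over the facets [k]. *)
Definition diag (h : cell C) : chain K stretch_cell := face (pt h h) - Seg h (bd h).
Definition Diag : chain K (cell C) -> chain K stretch_cell := ext diag.
Definition subdiv (h : cell C) : chain K stretch_cell :=
  if (dm h < i)%N then diag h else face (old h).

(** The boundary of a prism is its far end, minus its subdivided near end, minus its sides. An old
    cell is attached along the subdivision of its boundary. *)
Definition stretch_bd (x : stretch_cell) : chain K stretch_cell :=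
  match x with
  | inl (inl (h, f)) => Pt f (bd h)
  | inl (inr (h, f)) => face (pt h f) - diag h - Seg f (bd h)
  | inr g => ext subdiv (bd g)
  end.

Definition stretch : labelled_complex :=
  @LabelledComplex K stretch_cell (var C + cell C)%type stretch_live stretch_dm
    stretch_lab stretch_below stretch_bd.

Definition collapse (x : stretch_cell) : chain K (cell C) :=
  match x with
  | inl (inl (h, f)) => face h
  | inl (inr _) => 0
  | inr g => face g
  end.

(** The homotopy that pushes the copy [(h, f)] along the prism [[h, f]] onto the subdivided [h]; for
    [h = f] the prism is degenerate. *)
Definition sweep (x : stretch_cell) : chain K stretch_cell :=
  if x is inl (inl (h, f)) then (if h == f then 0 else face (seg h f)) else 0.

Hypothesis gC : resolution_complex i p c C.
Hypothesis c_lin : forall j, (j.+1 < i)%N -> c j.+1 = (c j).+1.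
Hypothesis i_range : (0 < i <= p)%N.

Local Notation B := (cell C).
Local Notation live := (@live K C).
Local Notation bd := (@bd K C).
Local Notation dm := (@dm K C).
Local Notation bd' := (ext stretch_bd).

Lemma facet_live (b y : B) : y \in facet_of i b -> y \in live.
Proof. by case/and4P. Qed.
Lemma facet_dm (b y : B) : y \in facet_of i b -> (dm y).+1 = dm b.
Proof. by case/and4P=> _ /eqP. Qed.
Lemma facet_lab (b y : B) : y \in facet_of i b -> lab y \subset lab b.
Proof. by case/and4P. Qed.
Lemma facet_below (b y : B) : y \in facet_of i b -> (dm b < i)%N -> below y b.
Proof. by case/and4P=> _ _ _ /implyP. Qed.

Lemma lowP (f : B) : f \in low -> f \in live /\ (dm f < i)%N.
Proof. by rewrite inE => /andP. Qed.

Lemma below_dm (x y : B) : below x y -> (dm x <= dm y)%N.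
Proof.
by move=> xy; have [-> //|/(rc_lt gC xy)/ltnW] := eqVneq x y.
Qed.

Lemma below_live (x y : B) : below x y -> x \in live.
Proof. by case/(rc_live gC)/andP. Qed.

Lemma below_low (x y : B) : below x y -> y \in low -> x \in low.
Proof.
move=> xy /lowP[_ ly]; rewrite inE (below_live xy) /=.
exact: leq_ltn_trans (below_dm xy) ly.
Qed.

(** * Boundary, collapse and homotopy of the stretched complex *)

Lemma stretch_bd_Pt f z : bd' (Pt f z) = Pt f (ext bd z).
Proof.
by rewrite /Pt !ext_comp; apply: eq_bigr => b _; rewrite ext_face.
Qed.

Lemma stretch_bd_Seg f z : bd' (Seg f z) = Pt f z - Diag z - Seg f (ext bd z).
Proof.
rewrite /Pt /Diag /Seg !ext_comp -!extNf -!extDf; apply: eq_bigr => b _.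
by rewrite ext_face.
Qed.

(** The far ends of the side prisms [Seg h (bd h)] cancel the boundary of the central copy, which
    leaves the subdivided boundary. *)
Lemma stretch_bd_diag h : h \in live -> bd' (diag h) = Diag (bd h).
Proof.
move=> hl; rewrite /diag linearB /= stretch_bd_Seg ext_face /= (rc_bdbd gC hl).
by rewrite /Seg linear0 subr0 opprB addrC subrK.
Qed.

Lemma bd_live (h : B) : h \in live -> on live (bd h).
Proof. by move=> hl; apply: on_sub (rc_bd gC hl) => y; apply: facet_live. Qed.

Lemma subdiv_low z : on low z -> ext subdiv z = Diag z.
Proof. by move=> lz; apply: eq_ext_on lz _ => b /lowP[_ lb]; rewrite /subdiv lb. Qed.

Lemma bd_low h : h \in low -> on low (bd h).
Proof.
move=> hl; have [lh dh] := lowP hl.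
apply: on_sub (rc_bd gC lh) => y fy; apply: below_low hl.
exact: facet_below fy dh.
Qed.

Lemma stretch_bd_subdiv h : h \in live -> bd' (subdiv h) = ext subdiv (bd h).
Proof.
move=> lh; rewrite {1}/subdiv; case: ifP => dh; last by rewrite ext_face.
by rewrite subdiv_low ?stretch_bd_diag //; apply: bd_low; rewrite inE lh.
Qed.

Lemma stretch_bdbd x : x \in stretch_live -> bd' (stretch_bd x) = 0.
Proof.
case: x => [[[h f]|[h f]]|g].
- by case/andP=> /below_live lh _; rewrite /= stretch_bd_Pt (rc_bdbd gC lh) /Pt linear0.
- case/and3P=> /below_live lh _ _ /=.
  rewrite 2!linearB /= ext_face /= stretch_bd_diag // stretch_bd_Seg (rc_bdbd gC lh).
  by rewrite /Seg linear0 subr0 subrr.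
- case/andP=> lg _ /=; rewrite ext_comp (eq_ext_on (bd_live lg) stretch_bd_subdiv).
  by rewrite -ext_comp (rc_bdbd gC lg) linear0.
Qed.

Lemma collapsePt f z : ext collapse (Pt f z) = z.
Proof.
by rewrite /Pt ext_comp -[RHS]ext_id; apply: eq_bigr => b _; rewrite ext_face.
Qed.

Lemma collapseSeg f z : ext collapse (Seg f z) = 0.
Proof. by rewrite /Seg ext_comp -[RHS](ext0f _ z); apply: eq_bigr => b _; rewrite ext_face. Qed.

Lemma collapse_diag h : ext collapse (diag h) = face h.
Proof. by rewrite linearB /= collapseSeg subr0 ext_face. Qed.

Lemma collapse_subdiv z : ext collapse (ext subdiv z) = z.
Proof.
rewrite ext_comp -[RHS]ext_id; apply: eq_bigr => b _; rewrite /subdiv.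
by case: ifP => _; rewrite ?collapse_diag ?ext_face.
Qed.

Lemma collapse_bd x : x \in stretch_live -> ext bd (collapse x) = ext collapse (stretch_bd x).
Proof.
case: x => [[[h f]|[h f]]|g] _ /=.
- by rewrite ext_face collapsePt.
- by rewrite 2!linearB /= linear0 collapseSeg collapse_diag ext_face subrr subr0.
- by rewrite collapse_subdiv ext_face.
Qed.

Lemma sweepSeg f z : ext sweep (Seg f z) = 0.
Proof. by rewrite /Seg ext_comp -[RHS](ext0f _ z); apply: eq_bigr => b _; rewrite ext_face. Qed.

Lemma sweep_diag h : ext sweep (diag h) = 0.
Proof. by rewrite linearB /= sweepSeg ext_face /= eqxx subr0. Qed.

Lemma sweep_subdiv z : ext sweep (ext subdiv z) = 0.
Proof.
rewrite ext_comp -[RHS](ext0f _ z); apply: eq_bigr => b _; rewrite /subdiv.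
by case: ifP => _; rewrite ?sweep_diag ?ext_face.
Qed.

(** A facet of [h] has smaller dimension than [f], so the degenerate case of [sweep] does not
    occur. *)
Lemma sweepPt_bd h f : below h f -> f \in low -> ext sweep (Pt f (bd h)) = Seg f (bd h).
Proof.
move=> hf fl; rewrite /Pt ext_comp; have lh := below_live hf.
apply: eq_ext_on (rc_bd gC lh) _ => k fk; rewrite ext_face /=.
case: eqVneq => // kf; have := facet_dm fk; have := below_dm hf.
by rewrite kf => h1 h2; move: h1; rewrite -h2 ltnn.
Qed.

(** For a copy with [h != f] this is the boundary formula of its prism rearranged, for [h = f] the
    definition of [diag]. For a prism, [sweep] kills every term of the boundary except [pt h f],
    which it sends back to the prism. *)
Lemma homotopy x : x \in stretch_live ->
  face x = ext subdiv (collapse x) + bd' (sweep x) + ext sweep (stretch_bd x).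
Proof.
case: x => [[[h f]|[h f]]|g].
- case/andP=> hf fl; rewrite /= (sweepPt_bd hf fl) ext_face /subdiv.
  have /lowP[_ ->] := below_low hf fl.
  case: eqVneq => [<-|nhf]; first by rewrite linear0 addr0 subrK.
  by rewrite ext_face /= -addrA subrK addrC subrK.
- case/and3P=> hf nhf fl /=.
  by rewrite !linear0 !add0r 2!linearB /= sweep_diag sweepSeg ext_face /= (negbTE nhf) !subr0.
- case/andP=> lg ig /=; rewrite sweep_subdiv linear0 !addr0 ext_face /subdiv.
  by rewrite ltnNge ig.
Qed.

(** * Acyclicity of the stretched complex under a monomial *)

Lemma stretch_labE x (W : {set (var C + cell C)%type}) :
  (@lab K stretch x \subset W) =
  (lab (under x) \subset inl @^-1: W) && (new_vars x \subset inr @^-1: W).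
Proof. by rewrite /= /stretch_lab subUset !sub_imset_pre. Qed.

Lemma under_live x : x \in stretch_live -> under x \in live.
Proof.
case: x => [[[h f]|[h f]]|g] /=; first by case/andP=> /below_live.
- by case/and3P=> /below_live.
- by case/andP.
Qed.

Lemma on_Seg (A : {pred stretch_cell}) h f :
  h \in live -> (forall k, k \in facet_of i h -> seg k f \in A) -> on A (Seg f (bd h)).
Proof.
by move=> lh hA; apply: on_ext (rc_bd gC lh) _ => k /hA; apply: on_face.
Qed.

Lemma on_diag (A : {pred stretch_cell}) h :
  h \in live -> pt h h \in A -> (forall k, k \in facet_of i h -> seg k h \in A) ->
  on A (diag h).
Proof.
by move=> lh hh hA; apply: onD; [apply: on_face | apply/onN/on_Seg].
Qed.

(** For monomials containing every new variable: [S'] contracts along [sweep] onto the subdivision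
    of [S]. *)
Lemma exact_full (S : {pred B}) (S' : {pred stretch_cell}) :
    {subset S <= live} -> {subset S' <= stretch_live} ->
    (forall x, x \in S' -> under x \in S) ->
    (forall h, h \in S -> on S' (subdiv h)) ->
    (forall x, x \in S' -> on S' (sweep x)) ->
  exact_on bd dm S -> exact_on stretch_bd stretch_dm S'.
Proof.
move=> Sl S'l uS sS swS.
apply: (exact_transfer (s := subdiv) (r := collapse) (H := sweep)) => //.
- move=> x /uS; case: x => [[[h f]|[h f]]|g] /= hS; try exact: on_face.
  exact: on0.
- by move=> b /Sl; apply: stretch_bd_subdiv.
- by move=> x /S'l; apply: collapse_bd.
- move=> h hS; have lh := Sl h hS; rewrite /subdiv; case: ifP => _; rewrite ?aug_face //.
  rewrite linearB /= aug_face /= [aug _ _](_ : _ = 0) ?subr0 //.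
  rewrite /Seg /ext linear_sum big1 // => b _; rewrite linearZ /= aug_face /=.
  by rewrite mulr0.
- move=> x _; case: x => [[[h f]|[h f]]|g] /=; rewrite ?aug_face //.
  by rewrite linear0.
- by move=> x /S'l; apply: homotopy.
Qed.

(** When only copies at level [f] are present, [collapse] is an isomorphism onto [S] and the zero
    homotopy works. *)
Lemma exact_slice f (S : {pred B}) (S' : {pred stretch_cell}) :
    (forall x, x \in S' -> exists2 h, x = pt h f & h \in S) ->
    (forall h, h \in S -> pt h f \in S') ->
  exact_on bd dm S -> exact_on stretch_bd stretch_dm S'.
Proof.
move=> S'S SS'.
apply: (exact_transfer (s := fun h => face (pt h f)) (r := collapse) (H := fun=> 0)).
- by move=> h /SS'; apply: on_face.
- by move=> x /S'S[h -> hS]; apply: on_face.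
- by move=> x _; apply: on0.
- by move=> h _; rewrite ext_face.
- by move=> x /S'S[h -> _] /=; rewrite ext_face collapsePt.
- by move=> h _; rewrite aug_face.
- by move=> x /S'S[h -> _]; rewrite /= aug_face.
- by move=> x /S'S[h -> _] /=; rewrite linear0 ext0f ext_face !addr0.
Qed.

Lemma res_slice f (S' : {pred stretch_cell}) :
    (forall x, x \in S' -> exists h, x = pt h f) ->
    supports_resolution [pred k | pt k f \in S'] ->
  @supports_resolution stretch S'.
Proof.
move=> S'S res W [x xS' xW].
have [h xh] := S'S x xS'; rewrite xh in xS' xW.
have := xW; rewrite stretch_labE => /andP[/= hW fW].
apply: (@exact_slice f [pred k | (pt k f \in S') && (lab k \subset inl @^-1: W)]).
- move=> y /andP[/= yS' yW]; have [k yk] := S'S y yS'; exists k => //.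
  by rewrite inE -yk yS' /=; move: yW; rewrite stretch_labE yk => /andP[].
- move=> k /andP[/= kS' kW]; rewrite inE kS' /=.
  by rewrite stretch_labE /= kW.
- by apply: res; exists h.
Qed.

(** One statement serves the whole complex and the down-set of a prism. If [W] has all new
    variables, [exact_full] applies. If it misses that of [f], every cell of [S'] under it is a copy
    at level [f], since all others carry this variable. *)
Lemma res_stretch (S : {pred B}) (S' : {pred stretch_cell}) :
    {subset S <= live} -> {subset S' <= stretch_live} ->
    (forall x, x \in S' -> under x \in S) ->
    (forall h, h \in S -> h \in low -> pt h h \in S') ->
    (forall h, h \in S -> h \notin low -> old h \in S') ->
    (forall h k, h \in S -> h \in low -> k \in facet_of i h -> seg k h \in S') ->
    (forall h f, h != f -> pt h f \in S' -> seg h f \in S') ->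
    supports_resolution S ->
    (forall f, f \in low -> supports_resolution [pred k | pt k f \in S']) ->
  @supports_resolution stretch S'.
Proof.
move=> Sl S'l uS ptS oldS segS swS res resf W [x xS' xW].
have := xW; rewrite stretch_labE => /andP[xW1 xW2].
have [/subsetP lowW|nlowW] := boolP (low \subset inr @^-1: W).
  have nvW y : y \in S' -> new_vars y \subset inr @^-1: W.
    move=> _; apply: subset_trans (_ : low \subset _); last exact/subsetP.
    by case: y => [[[k l]|[k l]]|g] //=; apply: subsetDl.
  apply: (@exact_full [pred b | (b \in S) && (lab b \subset inl @^-1: W)]).
  - by move=> b /andP[/Sl].
  - by move=> b /andP[/S'l].
  - by move=> y /andP[/= yS']; rewrite stretch_labE inE uS //= => /andP[].
  - move=> h /andP[/= hS hW]; have lh := Sl h hS.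
    rewrite /subdiv; case: ifPn => dh; last first.
      apply: on_face; have hS' : old h \in S' by apply: oldS; rewrite // inE lh.
      by rewrite inE hS' /= stretch_labE nvW //= hW.
    have hl : h \in low by rewrite inE lh.
    apply: on_diag => // [|k kh].
      by rewrite inE ptS //= stretch_labE hW nvW // ptS.
    rewrite inE segS //= stretch_labE nvW ?segS //= andbT.
    exact: subset_trans (facet_lab kh) hW.
  - case=> [[[h f]|[h f]]|g] /andP[/= yS']; rewrite stretch_labE => /andP[/= hW _];
      try exact: on0.
    case: eqVneq => [_|hf]; first exact: on0.
    by apply: on_face; rewrite inE swS //= stretch_labE hW nvW // swS.
  - by apply: res; exists (under x); first exact: uS.
have /subsetPn[f fl fW] := nlowW.
have slice y : y \in S' -> @lab K stretch y \subset W ->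
    exists h, [/\ y = pt h f, lab h \subset inl @^-1: W & low :\ f \subset inr @^-1: W].
  move=> yS'; rewrite stretch_labE => /andP[]; case: y yS' => [[[h l]|[h l]]|g] /= yS' hW nW.
  - exists h; case: (eqVneq l f) nW => [-> nW|fl' nW]; first by split.
    by case/negP: fW; apply: (subsetP nW); rewrite in_setD1 fl eq_sym fl'.
  - by rewrite nW in nlowW.
  - by rewrite nW in nlowW.
have [h [xh hW fW']] := slice x xS' xW; rewrite xh in xS'.
apply: (@exact_slice f [pred k | (pt k f \in S') && (lab k \subset inl @^-1: W)]).
- move=> y /andP[/= yS' yW]; have [k [yk kW _]] := slice y yS' yW; exists k => //.
  by rewrite inE -yk yS'.
- move=> k /andP[/= kS' kW]; rewrite inE kS' /=.
  by rewrite stretch_labE /= kW.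
- by apply: (resf f fl); exists h.
Qed.

(** Under dimension [i] one new variable less is counted, so only the jump from [i - 1] to [i]
    grows, by one. The predecessor does not truncate, by [low_gt0]. *)
Definition stretch_deg (j : nat) : nat :=
  if (j < i)%N then (c j + #|low|).-1 else (c j + #|low|)%N.

Lemma low_gt0 : (0 < #|low|)%N.
Proof.
have [b lb db] := rc_ex gC (leq0n p).
by apply/card_gt0P; exists b; rewrite inE lb db; case/andP: i_range.
Qed.

Lemma stretch_labS x y :
  lab (under x) \subset lab (under y) -> new_vars x \subset new_vars y ->
  @lab K stretch x \subset @lab K stretch y.
Proof. by move=> l1 l2; apply: setUSS; apply: imsetS. Qed.

Lemma card_stretch_lab x : x \in stretch_live ->
  #|@lab K stretch x| = stretch_deg (stretch_dm x).
Proof.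
move=> lx; rewrite /= /stretch_lab cardsU.
rewrite (_ : _ :&: _ = set0) ?cards0 ?subn0; last first.
  apply/setP=> z; rewrite !inE; apply/negP=> /andP[/imsetP[u _ ->]] /imsetP[] //.
rewrite !card_imset; try by move=> ? ? [].
rewrite (rc_card gC (under_live lx)) /stretch_deg; have lg := low_gt0.
case: x lx => [[[h f]|[h f]]|g] /=.
- case/andP=> hf fl; have /lowP[_ ->] := below_low hf fl.
  by rewrite (cardsD1 f low) fl add1n addnS.
(* The prism has one new variable more than a copy of [h], and one dimension more; [c_lin] balances
   the two. *)
- case/and3P=> hf nhf fl; have [_ df] := lowP fl.
  have := rc_lt gC hf nhf => hd; have h1 : ((dm h).+1 < i)%N by apply: leq_ltn_trans df.
  by rewrite h1 c_lin.
- by case/andP=> _; rewrite leqNgt => /negbTE ->.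
Qed.

(** * Face order, boundary supports and down-sets *)

Lemma stretch_below_live x y : stretch_below x y -> (x \in stretch_live) && (y \in stretch_live).
Proof. by case/and3P=> -> ->. Qed.

Lemma stretch_below_refl x : x \in stretch_live -> stretch_below x x.
Proof.
move=> lx; rewrite /stretch_below lx /=.
case: x lx => [[[h f]|[h f]]|g] /=.
- by case/andP=> /below_live /(rc_refl gC) -> _; rewrite eqxx.
- by case/and3P=> /below_live /(rc_refl gC) -> _; rewrite eqxx.
- by rewrite eqxx.
Qed.

Lemma stretch_below_trans : transitive stretch_below.
Proof.
have tr (a b d : B) : below a b -> below b d -> below a d by move=> /(rc_trans gC); apply.
move=> y x z /and3P[lx _ xy] /and3P[_ lz yz]; rewrite /stretch_below lx lz /=.
case: x y z xy yz {lx lz} => [[[k l]|[k l]]|g] [[[k' l']|[k' l']]|g'] [[[h f]|[h f]]|g''] //=.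
- by case/andP=> /tr xy /eqP-> /andP[/xy -> ->].
- by case/andP=> /tr xy /eqP-> /andP[/xy -> ->].
- case/andP=> /tr xy ll /andP[yz]; rewrite (xy _ yz) /=.
  by case/orP: ll => [/eqP-> //|/tr/(_ yz) ->]; rewrite orbT.
- case/andP=> /tr xy ll /andP[yz]; rewrite (xy _ yz) /=.
  by case/orP: ll => [/eqP-> //|/tr/(_ yz) ->]; rewrite orbT.
- by move=> /eqP->.
Qed.

Lemma stretch_below_lt x y : stretch_below x y -> x != y -> (stretch_dm x < stretch_dm y)%N.
Proof.
case/and3P=> lx _; case: x y lx => [[[k l]|[k l]]|g] [[[h f]|[h f]]|g'] //= lx.
- case/andP=> kh /eqP->; have [->|/(rc_lt gC kh) //] := eqVneq k h.
  by rewrite eqxx.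
- by case/andP=> /below_dm kh _ _; rewrite ltnS.
(* If [k = h], then [l] below [h] would contradict that [k] lies strictly below [l]; so [l = f] and
   the prisms coincide. *)
- case/andP=> kh lf; rewrite ltnS; have [ekh|/(rc_lt gC kh) //] := eqVneq k h.
  case/orP: lf => [/eqP->|lh]; first by rewrite ekh eqxx.
  case/and3P: lx => kl nkl _ _; have := rc_lt gC kl nkl.
  by rewrite ltnNge ekh (below_dm lh).
- by move=> /eqP->; rewrite eqxx.
Qed.

Lemma stretch_facet x : x \in stretch_live ->
  on (@facet_of stretch i x) (stretch_bd x).
Proof.
have fE y z : y \in stretch_live -> z \in stretch_live ->
    (stretch_dm y).+1 = stretch_dm z -> @lab K stretch y \subset @lab K stretch z ->
    ((stretch_dm z < i)%N -> stretch_below y z) -> y \in @facet_of stretch i z.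
  by move=> ly lz dyz lyz byz; apply/and4P; split; rewrite //= ?dyz //; apply/implyP.
have facet_ne (h k : B) : k \in facet_of i h -> k != h.
  by move=> kh; apply/eqP=> ekh; have := facet_dm kh; rewrite ekh => /esym/n_Sn.
have tr (a b d : B) : below a b -> below b d -> below a d by move=> /(rc_trans gC); apply.
move=> lx; case: x lx => [[[h f]|[h f]]|g] lx.
- case/andP: (lx) => hf fl; have lh := below_live hf.
  have /lowP[_ dh] := below_low hf fl.
  apply: on_ext (rc_bd gC lh) _ => k kh; apply: on_face.
  have bkh := facet_below kh dh.
  have lk : pt k f \in stretch_live by apply/andP; split=> //; apply: tr hf.
  apply: fE => //; first exact: facet_dm kh.
    exact/stretch_labS/subxx/(facet_lab kh).
  by move=> _; rewrite /stretch_below lk lx /= bkh eqxx.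
- case/and3P: (lx) => hf nhf fl; have lh := below_live hf.
  have hl := below_low hf fl; have [_ dh] := lowP hl; have rh := rc_refl gC lh.
  have lhf : pt h f \in stretch_live by apply/andP.
  have lhh : pt h h \in stretch_live by apply/andP.
  have segP k l : k \in facet_of i h -> l = f \/ l = h -> seg k l \in @facet_of stretch i (seg h f).
    move=> kh lE; have bkh := facet_below kh dh.
    have lkl : seg k l \in stretch_live.
      case: lE => ->; apply/and3P; split=> //; try exact: facet_ne.
        exact: tr hf.
      (* Were [k = f], then [f] would lie below its own proper face [h]. *)
      apply: contraNneq (facet_ne _ _ kh) => ekf; move: bkh; rewrite ekf => fh.
      have := rc_lt gC hf nhf; by rewrite ltnNge (below_dm fh).
    apply: fE => //; first by rewrite /= (facet_dm kh).
      exact/stretch_labS/subxx/(facet_lab kh).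
    move=> _; rewrite /stretch_below lkl lx /= bkh.
    by case: lE => ->; rewrite ?eqxx ?rh ?orbT.
  apply: onD; first apply: onD.
  + apply: on_face; apply: fE => //.
      by apply: stretch_labS => //; apply: subsetDl.
    by move=> _; rewrite /stretch_below lhf lx /= rh eqxx.
  + apply/onN/on_diag => // [|k kh]; last by apply: segP => //; right.
    apply: fE => //; first by apply: stretch_labS => //; apply: subsetDl.
    by move=> _; rewrite /stretch_below lhh lx /= rh orbT.
  + by apply/onN/on_Seg => // k kh; apply: segP => //; left.
- case/andP: (lx) => lg ig; apply: on_ext (rc_bd gC lg) _ => h hg.
  have dhg := facet_dm hg; have lh := facet_live hg; have labh := facet_lab hg.
  have big : (stretch_dm (old g) < i)%N -> false by rewrite ltnNge ig.
  rewrite /subdiv; case: ifPn => [dh|]; last first.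
    rewrite -leqNgt => dh; apply: on_face; apply: fE => //; first by apply/andP.
      exact: stretch_labS.
    by move/big.
  have hl : h \in low by rewrite inE lh.
  have rh := rc_refl gC lh.
  apply: on_diag => // [|k kh].
    apply: fE => //; first by apply/andP.
      by apply: stretch_labS => //; apply: subsetDl.
    by move/big.
  apply: fE => //.
  + by apply/and3P; split=> //; [apply: facet_below kh dh | apply: facet_ne].
  + by rewrite /= (facet_dm kh).
  + by apply: stretch_labS => //; apply: subset_trans (facet_lab kh) labh.
  + by move/big.
Qed.

Lemma stretch_aug x : x \in stretch_live -> aug stretch_dm (stretch_bd x) = 0.
Proof.
have augPt f z : aug stretch_dm (Pt f z) = aug dm z.
  by rewrite (aug_ext (dm := dm) (A := predT)) // => b _; rewrite aug_face.
have augSeg f z : aug stretch_dm (Seg f z) = 0.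
  by rewrite /Seg /ext linear_sum big1 // => b _; rewrite linearZ /= aug_face /= mulr0.
have aug_diag h : aug stretch_dm (diag h) = (dm h == 0)%:R.
  by rewrite linearB /= augSeg subr0 aug_face.
case: x => [[[h f]|[h f]]|g].
- by case/andP=> /below_live lh _; rewrite /= augPt (rc_aug gC lh).
- by move=> _; rewrite 2!linearB /= augSeg aug_diag aug_face subrr subr0.
- case/andP=> lg _ /=; rewrite (aug_ext (dm := dm) (A := predT)) ?(rc_aug gC lg) // => b _.
  by rewrite /subdiv; case: ifP => _; rewrite ?aug_diag ?aug_face.
Qed.

Lemma eq_res (D : labelled_complex) (S S' : {pred cell D}) :
  S =i S' -> supports_resolution S -> supports_resolution S'.
Proof.
move=> eS res W [b bS bW]; apply: eq_exact_on (res W _) => [x|]; first by rewrite !inE eS.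
by exists b; rewrite ?eS.
Qed.

Lemma res_empty (D : labelled_complex) (S : {pred cell D}) :
  S =i pred0 -> supports_resolution S.
Proof. by move=> S0 W [b]; rewrite S0. Qed.

Lemma stretch_res_live : @supports_resolution stretch stretch_live.
Proof.
apply: (res_stretch (S := live)) (rc_res gC) _ => //.
- exact: under_live.
- by move=> h lh hl; apply/andP; split=> //; apply: rc_refl gC _ lh.
- by move=> h lh; rewrite inE lh -leqNgt => dh; apply/andP.
- move=> h k lh hl kh; have [_ dh] := lowP hl; apply/and3P; split=> //.
    exact: facet_below kh dh.
  by apply/eqP=> ekh; have := facet_dm kh; rewrite ekh => /esym/n_Sn.
- by move=> h f nhf /andP[hf fl]; apply/and3P.
(* Level [f] is a copy of the closed cell [f], acyclic by [rc_down]. *)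
- move=> f fl; have [lf df] := lowP fl; apply: eq_res (rc_down gC lf df) => k.
  by rewrite !inE /pt [RHS]/in_mem /= fl andbT.
Qed.

(** Below a copy [(h, f)] lies a copy of the down-set of [h]. Among the copies below a prism
    [[h, f]], level [f] is the down-set of [h], level [l] is that of [l] when [l] is below [h], and
    all other levels are empty. *)
Lemma stretch_res_down x : x \in stretch_live -> (stretch_dm x < i)%N ->
  @supports_resolution stretch (@down stretch x).
Proof.
case: x => [[[h f]|[h f]]|g] lx.
- move=> dh; case/andP: (lx) => hf fl; have lh := below_live hf.
  apply: (res_slice (f := f)).
    move=> [[[k l]|[k l]]|g']; rewrite inE /= /stretch_below => /and3P[_ _] //.
    by case/andP=> _ /eqP->; exists k.
  apply: eq_res (rc_down gC lh dh) => k; rewrite !inE /= /stretch_below lx /= eqxx andbT.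
  rewrite [pt k f \in _]/in_mem /= fl andbT andbC; case bkh : (below k h) => //=.
  by apply/esym/(rc_trans gC bkh).
- move=> /= dh'; case/and3P: (lx) => hf nhf fl; have lh := below_live hf.
  have hl := below_low hf fl; have [_ dh] := lowP hl; have rh := rc_refl gC lh.
  apply: (res_stretch (S := down h)) (rc_down gC lh dh) _.
  + by move=> k; rewrite inE; apply: below_live.
  + by move=> y; rewrite inE => /stretch_below_live/andP[].
  + by case=> [[[k l]|[k l]]|g'] /and3P[_ _] //= /andP[].
  + move=> k kh kl; rewrite inE /= /stretch_below lx /=.
    rewrite inE in kh; rewrite kh orbT !andbT; apply/andP; split=> //.
    by apply: (rc_refl gC); apply: below_live kh.
  + move=> k; rewrite inE => kh; rewrite inE (below_live kh) /= -leqNgt => dk.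
    by have := leq_ltn_trans (leq_trans dk (below_dm kh)) dh; rewrite ltnn.
  + move=> k m; rewrite inE => kh kl mk; have [_ dk] := lowP kl.
    have bmk := facet_below mk dk.
    rewrite inE /= /stretch_below lx /= kh orbT (rc_trans gC bmk kh) !andbT.
    apply/and3P; split=> //.
    by apply/eqP=> ekh; have := facet_dm mk; rewrite ekh => /esym/n_Sn.
  + move=> k l nkl; rewrite !inE /= /stretch_below lx /= => /andP[/andP[kl ll] ->].
    by rewrite andbT; apply/and3P.
  + move=> l ll; have [llive dl] := lowP ll.
    have E k : (k \in [pred k | pt k l \in @down stretch (seg h f)]) =
      [&& below k l, below k h & (l == f) || below l h].
      by rewrite !inE /= /stretch_below lx [pt k l \in _]/in_mem /= ll andbT.
    have [elf|nlf] := eqVneq l f.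
      apply: eq_res (rc_down gC lh dh) => k; rewrite E elf eqxx andbT inE andbC.
      by case bkh : (below k h) => //=; apply/esym/(rc_trans gC bkh).
    case blh : (below l h); last first.
      by apply: res_empty => k; rewrite E (negbTE nlf) blh !andbF.
    apply: eq_res (rc_down gC llive dl) => k; rewrite E blh orbT andbT inE.
    by case bkl : (below k l) => //=; apply/esym/(rc_trans gC bkl).
- by move=> /= dg; case/andP: lx => _; rewrite leqNgt dg.
Qed.

(** The threshold [i] is kept, so that the step can be repeated. *)
Theorem resolution_complex_stretch : resolution_complex i p stretch_deg stretch.
Proof.
split.
- exact: stretch_facet.
- exact: stretch_bdbd.
- exact: stretch_aug.
- exact: stretch_below_live.
- exact: stretch_below_refl.
- exact: stretch_below_trans.
- exact: stretch_below_lt.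
- exact: stretch_res_live.
- exact: stretch_res_down.
- exact: card_stretch_lab.
- move=> [[[h f]|[h f]]|g] /= lx.
  + by apply: (rc_le gC); apply: under_live lx.
  + case/and3P: lx => hf nhf /lowP[lf _].
    exact: leq_trans (rc_lt gC hf nhf) (rc_le gC lf).
  + by apply: (rc_le gC); apply: under_live lx.
- move=> j jp; have [b lb db] := rc_ex gC jp.
  have [dbi|dbi] := ltnP (dm b) i; last by exists (old b) => //; apply/andP.
  by exists (pt b b) => //; apply/andP; rewrite inE lb; split=> //; apply: rc_refl gC _ lb.
Qed.

End Step.

(** * The simplex and all degree types *)

(** The terms at [(u, v)] and [(v, u)] cancel; the diagonal is assumed zero because [x = - x] does
    not give this in characteristic two. *)
Lemma sum_antisym (V : zmodType) (m : nat) (T : 'I_m -> 'I_m -> V) :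
  (forall u, T u u = 0) -> (forall u v, T u v = - T v u) -> \sum_u \sum_v T u v = 0.
Proof.
move=> T0 Ta.
have -> : \sum_u \sum_v T u v =
    \sum_(u < m) \sum_(v < m | (u < v)%N) T u v + \sum_(u < m) \sum_(v < m | (v < u)%N) T u v.
  rewrite -big_split; apply: eq_bigr => u _ /=.
  rewrite (bigID (fun v : 'I_m => (u < v)%N)) /=; congr (_ + _).
  rewrite (bigD1 u) ?ltnn //= T0 add0r; apply: eq_bigl => v.
  by rewrite -leqNgt ltn_neqAle andbC.
rewrite [X in _ + X](exchange_big_dep predT) //= -big_split big1 // => u _ /=.
by rewrite -big_split big1 // => v _ /=; rewrite Ta addNr.
Qed.

Section Simplex.
Variables (K : fieldType) (p : nat).
Local Notation I := 'I_p.+1.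
Local Notation face := (@face K _).

(** The usual orientation sign: the exponent is the position of [v] in [b]. *)
Definition sgn (v : I) (b : {set I}) : K := (-1) ^+ #|[set u in b | (u < v)%N]|.

(** The empty face is not a cell; the augmentation takes its place. *)
Definition simplex_bd (b : {set I}) : chain K {set I} :=
  \sum_(v in b | b :\ v != set0) sgn v b *: face (b :\ v).

Definition simplex : labelled_complex K :=
  @LabelledComplex K {set I} I [pred b | b != set0] (fun b => #|b|.-1) id
    (fun x y => (x != set0) && (x \subset y)) simplex_bd.

Lemma sgnD1 (u v : I) (b : {set I}) : u \in b -> sgn v b = (-1) ^+ (u < v)%N * sgn v (b :\ u).
Proof.
move=> ub; rewrite /sgn -exprD; congr (_ ^+ _).
rewrite (cardsD1 u) inE ub /=; congr (_ + _)%N; apply: eq_card => x.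
by rewrite !inE andbA.
Qed.

Lemma sgn_swap (u v : I) (b : {set I}) : u \in b -> v \in b -> u != v ->
  sgn v b * sgn u (b :\ v) = - (sgn u b * sgn v (b :\ u)).
Proof.
move=> ub vb nuv; rewrite (sgnD1 v ub) (sgnD1 u vb).
have [uv|vu|/val_inj uv] := ltngtP u v; last by rewrite uv eqxx in nuv.
  by rewrite expr1 expr0; ring.
by rewrite expr1 expr0; ring.
Qed.

Lemma ext_simplex (B : finType) (phi : {set I} -> chain K B) b :
  ext phi (simplex_bd b) = \sum_(v in b | b :\ v != set0) sgn v b *: phi (b :\ v).
Proof.
by rewrite linear_sum; apply: eq_bigr => v _; rewrite linearZ /= ext_face.
Qed.

Lemma simplex_bdbd b : ext simplex_bd (simplex_bd b) = 0.
Proof.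
rewrite ext_simplex.
transitivity (\sum_(v < p.+1) \sum_(u < p.+1)
    if [&& v \in b, u \in b, u != v & b :\ v :\ u != set0] then
      sgn v b * sgn u (b :\ v) *: face (b :\ v :\ u) else 0).
  rewrite big_mkcond; apply: eq_bigr => v _ /=; rewrite -big_mkcond /=.
  have [vb|vb] := boolP (v \in b); last by rewrite big_pred0.
  have [bv|bv] := eqVneq (b :\ v) set0.
    by rewrite big_pred0 // => u; rewrite bv set0D eqxx !andbF.
  rewrite /simplex_bd scaler_sumr; apply: eq_big => [u|u _]; last by rewrite scalerA.
  by rewrite in_setD1 -andbA andbCA.
apply: sum_antisym => [u|u v]; first by rewrite eqxx /= !andbF.
rewrite setDDl [[set u] :|: _]setUC -setDDl [RHS]fun_if oppr0 andbCA eq_sym.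
by case: ifP => // /and4P[vb ub nuv _]; rewrite -scaleNr sgn_swap // eq_sym.
Qed.

Lemma sgn_single v w : sgn v [set w] = (-1) ^+ (w < v)%N.
Proof.
rewrite /sgn; congr (_ ^+ _); case wv : (w < v)%N.
  by apply: etrans (cards1 w); apply: eq_card => x; rewrite !inE; case: eqVneq => // ->.
by apply: eq_card0 => x; rewrite !inE; case: eqVneq => // ->.
Qed.

Lemma simplex_aug b : aug (fun x : {set I} => #|x|.-1) (simplex_bd b) = 0.
Proof.
(* Only edges have facets of dimension 0; every other sum is empty or vanishes termwise. *)
have [b2|b2] := eqVneq #|b| 2%N; last first.
  rewrite linear_sum big1 // => v /andP[vb]; rewrite -card_gt0 => bv.
  rewrite linearZ /= aug_face; case: eqP => [h|_]; last by rewrite mulr0.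
  by case/eqP: b2; move: h bv => /=; rewrite (cardsD1 v b) vb; case: #|_| => [|[|]].
have /eqP/cards2P[x [y [nxy ->]]] := b2.
rewrite /simplex_bd big_mkcondr /= big_setU1 ?inE //= big_set1.
have -> : [set x; y] :\ x = [set y].
  by apply/setP=> z; rewrite !inE; case: eqVneq => // ->; rewrite (negbTE nxy).
have -> : [set x; y] :\ y = [set x].
  by apply/setP=> z; rewrite !inE; case: eqVneq => [->|]; rewrite ?orbF // eq_sym (negbTE nxy).
have ne (z : I) : [set z] != set0 by apply/set0Pn; exists z; rewrite inE.
rewrite !ne linearD !linearZ /= !aug_face !cards1 eqxx !mulr1.
(* A vertex has sign 1 in its own singleton, so [sgn_swap] says that the two ends of the edge have
   opposite signs. *)
have := @sgn_swap x y [set x; y]; rewrite !inE !eqxx orbT nxy => /(_ isT isT isT).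
have -> : [set x; y] :\ x = [set y].
  by apply/setP=> z; rewrite !inE; case: eqVneq => // ->; rewrite (negbTE nxy).
have -> : [set x; y] :\ y = [set x].
  by apply/setP=> z; rewrite !inE; case: eqVneq => [->|]; rewrite ?orbF // eq_sym (negbTE nxy).
by rewrite !sgn_single !ltnn !expr0 !mulr1 => ->; rewrite subrr.
Qed.

(** The simplex on [X] is a cone and contracts to its least vertex [v], which has sign 1 in every
    face containing it. The comparison complex in [exact_transfer] is a point. *)
Lemma simplex_exact (X : {set I}) : X != set0 ->
  exact_on simplex_bd (fun x : {set I} => #|x|.-1) [pred b | (b != set0) && (b \subset X)].
Proof.
case/set0Pn=> v0 v0X.
have [v vX vmin] : exists2 v, v \in X & forall u, u \in X -> (v <= u)%N.
  by have [v vX vmin] := arg_minnP (fun u : I => val u) v0X; exists v.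
have sgv (b : {set I}) : b \subset X -> sgn v b = 1.
  move=> /subsetP bX; rewrite /sgn eq_card0 // => u; rewrite !inE.
  by apply/negbTE/negP => /andP[/bX/vmin]; rewrite leqNgt => /negbTE ->.
have neU (b : {set I}) : v |: b != set0 by apply/set0Pn; exists v; rewrite setU11.
pose H (b : {set I}) : chain K {set I} := if v \in b then 0 else face (v |: b).
have tt_exact : exact_on (fun _ : unit => 0 : chain K unit) (fun=> 0%N) predT.
  split=> [z _ _|]; last by exists (face tt); rewrite ?aug_face //; apply: on_sub (on_face (A := predT) _).
  rewrite /aug (bigD1 tt) //= big1 => [|[]] //; rewrite addr0 mulr1 => z0.
  exists 0; first exact: on0.
  by rewrite linear0; apply/ffunP=> -[]; rewrite z0 ffunE.
apply: (exact_transfer (s := fun=> face [set v])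
   (r := fun b => (#|b|.-1 == 0)%:R *: face tt) (H := H)) tt_exact => //.
- by move=> _ _; apply: on_face; rewrite inE sub1set vX andbT; apply/set0Pn; exists v; rewrite inE.
- move=> b /andP[/= _ bX]; rewrite /H; case: ifP => vb; first exact: on0.
  by apply: on_face; rewrite inE neU subUset sub1set vX.
- move=> _ _; rewrite ext_face linear0 /simplex_bd big1 // => u /andP[].
  by rewrite inE => /eqP ->; rewrite setDv eqxx.
- move=> b _; rewrite ext0f; symmetry.
  have := simplex_aug b; rewrite linear_sum ext_simplex => h.
  transitivity ((\sum_(u in b | b :\ u != set0) sgn u b * (#|b :\ u|.-1 == 0)%:R) *: face tt).
    by rewrite scaler_suml; apply: eq_bigr => u _; rewrite scalerA.
  rewrite (_ : \sum_(_ in _ | _) _ = 0) ?scale0r // -[RHS]h.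
  by apply: eq_bigr => u _; rewrite linearZ /= aug_face.
- by move=> _ _; rewrite aug_face cards1.
- by move=> b _; rewrite linearZ /= aug_face mulr1.
move=> b /andP[/= b0 bX]; rewrite linearZ /= ext_face ext_simplex /H.
(* If [v] lies in [b], only the facet [b :\ v] survives under [H] and gives back [b]; for [b =
   [set v]] the term from the point does. *)
case: ifPn => vb.
  rewrite linear0 addr0 big_mkcondr /= (bigD1 v) //= big1 => [|u /andP[ub nuv]]; last first.
    by rewrite in_setD1 vb [v == u]eq_sym nuv scaler0; case: ifP.
  rewrite addr0 sgv // scale1r !inE eqxx setD1K //.
  have [bv|bv] := eqVneq (b :\ v) set0.
    by rewrite addr0 -(setD1K vb) bv setU0 cards1 scale1r.
  have : (0 < #|b :\ v|)%N by rewrite card_gt0.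
  rewrite (cardsD1 v b) vb /=; case: #|_| => // n _.
  by rewrite scale0r add0r.
have cone u : u \in b -> v |: b :\ u = (v |: b) :\ u.
  by move=> ub; rewrite setDUl [[set v] :\ u](setDidPl _) // disjoints1 inE;
    apply: contraNneq vb => ->.
(* The boundary of a cone is its base minus the cone over the boundary of the base; when [b] is a
   single vertex, the latter is [v] itself. *)
have -> : ext simplex_bd (face (v |: b)) =
    face b - \sum_(u in b) sgn u b *: face (v |: b :\ u).
  rewrite ext_face /simplex_bd big_mkcondr /= big_setU1 //= setU1K // b0.
  rewrite sgv ?subUset ?sub1set ?vX // scale1r -sumrN; congr (_ + _).
  apply: eq_bigr => u ub; rewrite -cone // neU (sgnD1 u (setU11 v b)) setU1K //.
  rewrite -scaleNr ltn_neqAle vmin ?(subsetP bX) // andbT.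
  by rewrite [_ != _](contraNneq _ vb) ?expr1 ?mulN1r // => /val_inj ->.
have -> : \sum_(u in b) sgn u b *: face (v |: b :\ u) =
    (#|b|.-1 == 0)%:R *: face [set v] +
    \sum_(u in b | b :\ u != set0) sgn u b *: (if v \in b :\ u then 0 else face (v |: b :\ u)).
  rewrite (bigID (fun u => b :\ u == set0)) /=; congr (_ + _); last first.
    by apply: eq_bigr => u _; rewrite in_setD1 (negbTE vb) andbF.
  have [b1|b1] := eqVneq #|b| 1%N.
    have /eqP/cards1P[u ->] := b1; rewrite cards1 eqxx scale1r big_mkcondr big_set1 setDv eqxx.
    by rewrite sgn_single ltnn scale1r setU0.
  rewrite big_pred0 => [|u]; last first.
    apply/negP=> /andP[ub bu]; case/negP: b1.
    by rewrite (cardsD1 u) ub (eqP bu) cards0.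
  by move: b0 b1; rewrite -card_gt0; case: #|b| => [|[|n]] // _ _; rewrite scale0r.
by rewrite addrAC addrC subrK.
Qed.

(** The part under [W] is the full simplex on [S :&: W]. *)
Lemma simplex_res (S : {set I}) :
  @supports_resolution K simplex [pred b : {set I} | (b != set0) && (b \subset S)].
Proof.
move=> W [b /andP[/= b0 bS] bW].
apply: eq_exact_on (simplex_exact (X := S :&: W) _) => [x|].
  by rewrite !inE /= subsetI andbA.
by apply: contraNneq b0 => SW; rewrite -subset0 -SW subsetI bS.
Qed.

(** Down-sets of faces are full simplices, so every threshold [i] is allowed; the construction
    starts with [p]. *)
Lemma resolution_complex_simplex i : resolution_complex i p succn simplex.
Proof.
have res_eq (A : {pred {set I}}) (S : {set I}) :
    (forall b, (b \in A) = (b != set0) && (b \subset S)) -> @supports_resolution K simplex A.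
  by move=> AE; apply: eq_res (@simplex_res S) => b; rewrite AE inE.
split.
- move=> b /= b0; rewrite /simplex_bd; elim/big_rec: _ => [|v z /andP[vb bv] Az]; first exact: on0.
  apply: onD => //; apply/onZ/on_face; rewrite /facet_of inE /= bv subD1set implybT !andbT.
  rewrite [X in X && _]bv /= (cardsD1 v b) vb /=.
  by move: bv; rewrite -card_gt0; case: #|_|.
- by move=> b _; apply: simplex_bdbd.
- by move=> b _; apply: simplex_aug.
- move=> x y /andP[x0 xy]; rewrite [x \in _]x0 /=.
  by apply: contraNneq x0 => y0; rewrite -subset0 -y0.
- by move=> b b0; apply/andP; split.
- by move=> y x z /andP[x0 xy] /andP[_ yz]; apply/andP; split=> //; apply: subset_trans yz.
- move=> x y /andP[x0 xy] nxy /=.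
  have : (#|x| < #|y|)%N by apply: proper_card; rewrite properEneq nxy.
  by move: x0; rewrite -card_gt0; case: #|x| => // n _; case: #|y|.
- by apply: (res_eq _ setT) => b; rewrite subsetT andbT.
- by move=> f _ _; apply: (res_eq _ f).
- by move=> b /=; rewrite inE -card_gt0; case: #|b|.
- by move=> b _ /=; have := max_card (mem b); rewrite card_ord; case: #|b|.
- move=> j jp; pose b : {set I} := [set x in take j.+1 (enum I)].
  have cb : #|b| = j.+1.
    rewrite cardsE (card_uniqP _) ?take_uniq ?enum_uniq // size_take size_enum_ord.
    by rewrite ltnS; case: ltngtP jp => // ->.
  by exists b; rewrite /= ?cb // inE -card_gt0 cb.
Qed.
End Simplex.

(** Used to pass to the next lower difference once one is finished. *)
Lemma resolution_complex_weaken (K : fieldType) i i' p c (C : labelled_complex K) :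
  (i' <= i)%N -> resolution_complex i p c C -> resolution_complex i' p c C.
Proof.
move=> ii [h1 h2 h3 h4 h5 h6 h7 h8 h9 h10 h11 h12]; split=> //.
  move=> b lb; apply: on_sub (h1 b lb) => y /and4P[? ? ? /implyP h]; apply/and4P; split=> //.
  by apply/implyP=> bi; apply: h; apply: leq_trans ii.
by move=> f lf fi; apply: h9 => //; apply: leq_trans ii.
Qed.

(* [e j] is c_(j+1) - c_j, that is d_(j+1) of the degree type. *)
Definition realizable (K : fieldType) (p i : nat) (e : nat -> nat) : Prop :=
  exists c (C : labelled_complex K), resolution_complex i p c C /\ forall j, (j < p)%N -> c j.+1 = (c j + e j)%N.

Lemma eq_realizable K p i e e' : (forall j, (j < p)%N -> e j = e' j) ->
  realizable K p i e -> realizable K p i e'.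
Proof.
by move=> ee [c [C [gC ce]]]; exists c, C; split=> // j jp; rewrite ce // ee.
Qed.

(** Stretching at threshold [i.+1] raises the jump from dimension [i] to [i.+1], which is [e i]; the
    ones at smaller indices are what [c_lin] asks for. *)
Lemma realizable_raise (K : fieldType) p i e : (i < p)%N -> (forall j, (j < i)%N -> e j = 1%N) ->
  realizable K p i.+1 e -> realizable K p i.+1 (fun j => e j + (j == i))%N.
Proof.
move=> ip e1 [c [C [gC ce]]].
exists (stretch_deg i.+1 c C), (stretch i.+1 C); split.
  apply: resolution_complex_stretch => // j; rewrite ltnS => ji.
  by rewrite ce ?(leq_trans ji (ltnW ip)) // e1 // addn1.
have lg := low_gt0 (i := i.+1) gC ip.
move=> j jp; rewrite /stretch_deg; have := ce j jp.
have := e1 j; move: (e j) (c j) (c j.+1) lg; move: #|_| => L x y z.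
by rewrite !ltnS; case: (ltngtP j i) => ji /=; lia.
Qed.

Lemma realizable_all (K : fieldType) p e : (forall j, (j < p)%N -> (0 < e j)%N) ->
  realizable K p 0 e.
Proof.
move=> e_gt0.
(* After [k] rounds the top [k] differences have their final values and the others are still 1. *)
suff H k : (k <= p)%N -> realizable K p (p - k) (fun j => if (j < p - k)%N then 1 else e j)%N.
  by have := H p (leqnn p); rewrite subnn; apply: eq_realizable.
elim: k => [|k IH] kp.
  exists succn, (simplex K p); split; first exact: resolution_complex_simplex.
  by move=> j jp; rewrite subn0 jp addn1.
have := IH (ltnW kp); set i := (p - k.+1)%N; have -> : (p - k = i.+1)%N by rewrite /i; lia.
have ip : (i < p)%N by rewrite /i; lia.
move=> R.
(* Each stretching adds one, so [m] of them lead from 1 to [m.+1]. *)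
suff H m : (m < e i)%N -> realizable K p i.+1
    (fun j => if (j < i)%N then 1 else if j == i then m.+1 else e j)%N.
  have [c [C [gC ce]]] := H (e i).-1 ltac:(by rewrite prednK // e_gt0).
  exists c, C; split; first exact: resolution_complex_weaken gC.
  by move=> j jp; rewrite ce //; case: ltngtP => // ->; rewrite prednK // e_gt0.
elim: m => [|m IHm] me.
  apply: eq_realizable R => j jp; rewrite ltnS; by case: ltngtP.
have R' := IHm (ltnW me); apply: eq_realizable (realizable_raise ip _ R') => [j jp|j ->] //.
by case: ltngtP => _; rewrite ?addn0 ?addn1.
Qed.

(** * From labelled complexes to free resolutions *)

Lemma mcoeffMX_le (R : nzRingType) n (p : {mpoly R[n]}) k m :
  (p * 'X_[k])@_m = if (k <= m)%MM then p@_(m - k)%MM else 0.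
Proof.
case: ifPn => [le_km|nle]; first by rewrite -[in LHS](submK le_km) addmC mcoeffMX.
rewrite [p]mpolyE mulr_suml raddf_sum big1 // => j _ /=.
rewrite -scalerAl -mpolyXD mcoeffZ mcoeffX.
by case: eqP => [jk|_]; rewrite ?mulr0 //; case/negP: nle; rewrite -jk lem_addl.
Qed.

Lemma lem_add_sub n (k l m : 'X_{1..n}) :
  (k + l <= m)%MM = (l <= m)%MM && (k <= m - l)%MM.
Proof.
apply/mnm_lepP/andP => [h|[/mnm_lepP h1 /mnm_lepP h2] j].
  by split; apply/mnm_lepP => j; have := h j; rewrite !mnmE; lia.
by have := h1 j; have := h2 j; rewrite !mnmE; lia.
Qed.

Section SquarefreeMonomials.
Variable n : nat.

Definition mono (s : {set 'I_n}) : 'X_{1..n} := [multinom (k \in s : nat) | k < n].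

Lemma mdeg_mono s : mdeg (mono s) = #|s|.
Proof.
rewrite mdegE -sum1_card [RHS]big_mkcond /=; apply: eq_bigr => k _.
by rewrite mnmE; case: (k \in s).
Qed.

Lemma mono_prod (K : fieldType) s : 'X_[mono s] = \prod_(k in s) 'X_k :> {mpoly K[n]}.
Proof.
rewrite mpolyXE_id [RHS]big_mkcond; apply: eq_bigr => k _.
by rewrite mnmE; case: (k \in s); rewrite ?expr1 ?expr0.
Qed.

Definition msupport (m : 'X_{1..n}) : {set 'I_n} := [set k | 0 < m k]%N.

Lemma mono_le s m : (mono s <= m)%MM = (s \subset msupport m).
Proof.
apply/mnm_lepP/subsetP => [h k ks|h k].
  by rewrite inE; have := h k; rewrite mnmE ks.
by rewrite mnmE; case ks : (k \in s) => //; have := h k ks; rewrite inE.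
Qed.

Lemma mono_setD (s t : {set 'I_n}) : t \subset s -> mono s = (mono (s :\: t) + mono t)%MM.
Proof.
move=> /subsetP ts; apply/mnmP=> k; rewrite !mnmE !inE.
by have := ts k; case: (k \in t) => [/(_ isT) ->|_]; rewrite ?addn0.
Qed.
End SquarefreeMonomials.

(** * Exactness over the polynomial ring, one multidegree at a time *)

Section Resolution.
Variables (K : fieldType) (n : nat) (B : finType) (live : {pred B}) (dm : B -> nat).
Variables (lab : B -> {set 'I_n}) (bd : B -> chain K B).
Hypothesis bd_face : forall b y, b \in live -> bd b y != 0 ->
  [/\ y \in live, (dm y).+1 = dm b, lab y \subset lab b & (#|lab y| < #|lab b|)%N].
Hypothesis bdbd : forall b, b \in live -> ext bd (bd b) = 0.
Hypothesis bd_aug : forall b, b \in live -> aug dm (bd b) = 0.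
Hypothesis acyclic : forall W : {set 'I_n}, (exists2 b, b \in live & lab b \subset W) ->
  exact_on bd dm [pred b | (b \in live) && (lab b \subset W)].

Local Notation mp := {mpoly K[n]}.

Definition cells (i : nat) : {set B} := [set b in live | dm b == i].

(** The homogenized boundary: each coefficient is multiplied by the quotient of the two label
    monomials. All dimensions are kept together. *)
Definition poly_bd (z : B -> mp) (y : B) : mp :=
  \sum_b z b * (bd b y *: 'X_[mono (lab b :\: lab y)]).

Definition poly_aug (z : B -> mp) : mp :=
  \sum_b z b * ((dm b == 0%N)%:R *: 'X_[mono (lab b)]).

Definition strand (z : B -> mp) (m : 'X_{1..n}) : chain K B :=
  [ffun b => if (mono (lab b) <= m)%MM then (z b)@_(m - mono (lab b))%MM else 0].

(* [strand z m] and [lift m] pass between multidegree [m] and the complex over [K]. *)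
Definition lift (m : 'X_{1..n}) (u : chain K B) (b : B) : mp :=
  u b *: 'X_[(m - mono (lab b))%MM].

Definition poly_live (z : B -> mp) := forall b, b \notin live -> z b = 0.

Lemma strand_on z m : poly_live z ->
  on [pred b | (b \in live) && (lab b \subset msupport m)] (strand z m).
Proof.
move=> lz b; rewrite ffunE inE -mono_le; case: ifP => [_|]; last by rewrite eqxx.
by rewrite andbT; apply: contraR => /lz ->; rewrite mcoeff0.
Qed.

(** Multiplying by the quotient of the labels of [b] and [y] moves the coefficient at [m] minus the
    label of [b] to [m] minus the label of [y]. *)
Lemma strand_bd z m : poly_live z -> ext bd (strand z m) = strand (poly_bd z) m.
Proof.
move=> lz; apply/ffunP=> y; rewrite /ext sum_ffunE ffunE.
transitivity (\sum_b (if (mono (lab y) <= m)%MM then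
   (z b * (bd b y *: 'X_[mono (lab b :\: lab y)]))@_(m - mono (lab y))%MM else 0)); last first.
  by case: ifP => _; rewrite ?raddf_sum // big1.
apply: eq_bigr => b _; rewrite ffunE [LHS]mulrC ffunE.
have [lb|/lz ->] := boolP (b \in live); last by rewrite mul0r !mcoeff0 !if_same mulr0.
have [->|bdy] := eqVneq (bd b y) 0; first by rewrite mul0r scale0r mulr0 mcoeff0 if_same.
have [_ _ sub _] := bd_face lb bdy.
rewrite -scalerAr mcoeffZ mcoeffMX_le (mono_setD sub) lem_add_sub addmC -submDA.
by case: (mono (lab y) <= m)%MM; rewrite /= ?mulr0.
Qed.

Lemma strand_aug z m : aug dm (strand z m) = (poly_aug z)@_m.
Proof.
rewrite raddf_sum; apply: eq_bigr => b _; rewrite ffunE /= -scalerAr mcoeffZ mcoeffMX_le.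
by rewrite mulrC.
Qed.

Lemma lift_bd m u y :
  on [pred b | (b \in live) && (lab b \subset msupport m)] u ->
  poly_bd (lift m u) y = lift m (ext bd u) y.
Proof.
move=> Au; rewrite /poly_bd /lift /ext sum_ffunE scaler_suml; apply: eq_bigr => b _.
rewrite ffunE.
have [->|/Au/andP[/= lb]] := eqVneq (u b) 0; first by rewrite !scale0r mul0r.
rewrite -mono_le => le.
have [->|bdy] := eqVneq (bd b y) 0; first by rewrite scale0r mulr0 scaler0 scale0r.
have [_ _ sub _] := bd_face lb bdy.
rewrite -scalerAr -scalerAl scalerA mulrC -mpolyXD; congr (_ *: 'X_[_]).
move: le; rewrite (mono_setD sub) lem_add_sub => /andP[_ le].
by rewrite [(mono _ + mono _)%MM]addmC -submDA submK.
Qed.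

Lemma strand_decomp (z : B -> mp) : exists M : seq 'X_{1..n},
  forall b, z b = \sum_(m <- M) lift m (strand z m) b.
Proof.
(* All multidegrees occurring in [z], without repetition so that each strand counts once. *)
exists (undup (flatten [seq [seq (k + mono (lab b))%MM | k <- msupp (z b)] | b <- enum B])).
move=> b; set M := undup _; apply/mpolyP=> k; rewrite raddf_sum /=.
transitivity (\sum_(m <- M) (if m == (k + mono (lab b))%MM then (z b)@_k else 0)); last first.
  apply: eq_bigr => m _; rewrite /lift mcoeffZ mcoeffX ffunE.
  case: eqP => [->|ne]; first by rewrite lem_addl addmK eqxx mulr1.
  case: ifP => le; last by rewrite mul0r.
  by case: eqP => [e|_]; rewrite ?mulr0 //; case: ne; rewrite -e submK.
rewrite -big_mkcond; have [kz|kz] := boolP (k \in msupp (z b)); last first.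
  by rewrite (memN_msupp_eq0 kz) big1.
have kM : (k + mono (lab b))%MM \in M.
  rewrite mem_undup; apply/flatten_mapP; exists b; first by rewrite mem_enum.
  exact: map_f.
by rewrite -big_filter filter_pred1_uniq ?undup_uniq // big_seq1.
Qed.

Lemma poly_exact z : poly_live z -> (forall y, poly_bd z y = 0) -> poly_aug z = 0 ->
  exists w, poly_live w /\ forall y, poly_bd w y = z y.
Proof.
move=> lz bz az.
have strandE m : exists2 u, on [pred b | (b \in live) && (lab b \subset msupport m)] u &
    ext bd u = strand z m.
  (* [acyclic] speaks only of sets [W] containing some label, so a zero strand is treated apart. *)
  have [z0|] := eqVneq (strand z m) 0.
    by exists 0; [apply: on0 | rewrite linear0 z0].
  move=> nz; have /existsP[b zb] : [exists b, strand z m b != 0].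
    apply: contraNT nz; rewrite negb_exists => /forallP h; apply/eqP/ffunP=> b.
    by have := h b; rewrite negbK ffunE => /eqP->; rewrite ffunE.
  have /andP[/= lb bW] := strand_on lz zb.
  have [ex _] := acyclic (ex_intro2 _ _ b lb bW).
  apply: ex; first exact: strand_on.
    by rewrite strand_bd //; apply/ffunP=> y; rewrite !ffunE bz mcoeff0 if_same.
  by rewrite strand_aug az mcoeff0.
have [M zE] := strand_decomp z.
suff [w [lw wE]] : exists w, poly_live w /\
    forall y, poly_bd w y = \sum_(m <- M) lift m (strand z m) y.
  by exists w; split=> // y; rewrite wE -zE.
elim: {zE} M => [|m M [w [lw wE]]].
  exists (fun=> 0); split=> // y; rewrite big_nil /poly_bd big1 // => b _.
  by rewrite mul0r.
have [u Au bu] := strandE m.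
exists (fun b => lift m u b + w b); split=> [b lb|y].
  rewrite lw // addr0 /lift; have [->|/Au/andP[/=]] := eqVneq (u b) 0; first by rewrite scale0r.
  by rewrite (negbTE lb).
rewrite big_cons -bu -lift_bd // -wE /poly_bd -big_split; apply: eq_bigr => b _ /=.
by rewrite mulrDl.
Qed.

Lemma poly_bd_out z y : poly_live z -> y \notin live -> poly_bd z y = 0.
Proof.
move=> lz ly; rewrite /poly_bd big1 // => b _.
have [lb|/lz ->] := boolP (b \in live); last by rewrite mul0r.
have [->|/(bd_face lb)[ly']] := eqVneq (bd b y) 0; first by rewrite scale0r mulr0.
by rewrite ly' in ly.
Qed.

Lemma poly_bdbd z y : poly_live z -> poly_bd (poly_bd z) y = 0.
Proof.
move=> lz; have lbz : poly_live (poly_bd z) by move=> x; apply: poly_bd_out.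
have [M ->] := strand_decomp (poly_bd (poly_bd z)); apply: big1 => m _.
rewrite -!strand_bd // ext_comp (ext0_on (strand_on lz)); first by rewrite /lift ffunE scale0r.
by move=> b /andP[/bdbd].
Qed.

Lemma poly_bd_aug z : poly_live z -> poly_aug (poly_bd z) = 0.
Proof.
move=> lz; apply/mpolyP=> m; rewrite mcoeff0 -strand_aug -strand_bd //.
rewrite /ext linear_sum big1 // => b _; rewrite linearZ /=.
have [->|/(strand_on lz)/andP[/bd_aug ->]] := eqVneq (strand z m b) 0; first by rewrite mul0r.
by rewrite mulr0.
Qed.

(** * Matrices and the Stanley-Reisner ideal *)

Definition label_resolution : free_sequence K n := @FreeSequence K n
  (fun i => #|cells i|)
  (fun i a => #|lab (enum_val a)|)
  (fun i => \matrix_(a, b) (bd (enum_val a) (enum_val b) *: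
                            'X_[mono (lab (enum_val a) :\: lab (enum_val b))]))
  (\col_a 'X_[mono (lab (enum_val a))]).

(** Extension by zero of a row vector to all of [B]: the sum has at most one term. *)
Definition spread i (v : 'rV[mp]_#|cells i|) (b : B) : mp :=
  \sum_(a | enum_val a == b) v 0 a.

Lemma cellsP i b : reflect (b \in live /\ dm b = i) (b \in cells i).
Proof. by rewrite inE; apply: (iffP andP) => -[lb /eqP]. Qed.

Lemma spread_enum i (v : 'rV[mp]_#|cells i|) a : spread v (enum_val a) = v 0 a.
Proof. by rewrite /spread (big_pred1 a) // => a'; rewrite (inj_eq enum_val_inj). Qed.

Lemma spread_out i (v : 'rV[mp]_#|cells i|) b : b \notin cells i -> spread v b = 0.
Proof.
by move=> nb; rewrite /spread big_pred0 // => a; apply: contraNF nb => /eqP <-; apply: enum_valP.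
Qed.

Lemma spread_live i (v : 'rV[mp]_#|cells i|) : poly_live (spread v).
Proof. by move=> b; rewrite -topredE => lb; apply: spread_out; apply: contra lb => /cellsP[]. Qed.

Lemma sum_spread i (v : 'rV[mp]_#|cells i|) (G : B -> mp) :
  \sum_a v 0 a * G (enum_val a) = \sum_b spread v b * G b.
Proof.
rewrite [RHS](bigID (fun b => b \in cells i)) /= [X in _ + X]big1 => [|b /spread_out ->]; last first.
  by rewrite mul0r.
by rewrite addr0 [RHS]big_enum_val; apply: eq_bigr => a _; rewrite spread_enum.
Qed.

Lemma mul_diff i (v : 'rV[mp]_#|cells i.+1|) a :
  (v *m fr_diff label_resolution i) 0 a = poly_bd (spread v) (enum_val a).
Proof.
rewrite mxE /poly_bd -sum_spread; apply: eq_bigr => b _; by rewrite mxE.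
Qed.

Lemma mul_aug (v : 'rV[mp]_#|cells 0|) :
  (v *m fr_aug label_resolution) 0 0 = poly_aug (spread v).
Proof.
rewrite mxE /poly_aug -sum_spread; apply: eq_bigr => b _; rewrite mxE.
by have /cellsP[_ ->] := enum_valP b; rewrite eqxx scale1r.
Qed.

Lemma spread_diff i (w : 'rV[mp]_#|cells i.+1|) :
  spread (w *m fr_diff label_resolution i) =1 poly_bd (spread w).
Proof.
move=> b; have [bi|bi] := boolP (b \in cells i).
  by rewrite -(enum_rankK_in bi bi) spread_enum mul_diff.
rewrite spread_out // /poly_bd big1 // => y _.
have [/cellsP[ly dy]|/spread_out ->] := boolP (y \in cells i.+1); last by rewrite mul0r.
have [->|/(bd_face ly)[lb db _ _]] := eqVneq (bd y b) 0; first by rewrite scale0r mulr0.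
by case/negP: bi; apply/cellsP; split=> //; apply/eq_add_S; rewrite db.
Qed.

Lemma poly_bd_eq z z' : z =1 z' -> poly_bd z =1 poly_bd z'.
Proof. by move=> e y; apply: eq_bigr => b _; rewrite e. Qed.

Lemma spread_lift i (v : 'rV[mp]_#|cells i|) :
  (forall y, poly_bd (spread v) y = 0) -> poly_aug (spread v) = 0 ->
  exists w, w *m fr_diff label_resolution i = v.
Proof.
move=> bv av; have [w [lw wE]] := poly_exact (spread_live v) bv av.
(* Only the part of [w] in dimension [i.+1] is kept; the rest has no boundary in dimension [i]. *)
exists (\row_a w (enum_val a)); apply/rowP=> a; rewrite mul_diff -spread_enum -wE.
apply: eq_bigr => b _; have [bi|bi] := boolP (b \in cells i.+1).
  by rewrite -{1}(enum_rankK_in bi bi) spread_enum mxE enum_rankK_in.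
rewrite spread_out // mul0r.
have [lb|/lw ->] := boolP (b \in live); last by rewrite mul0r.
have [->|/(bd_face lb)[_ db _ _]] := eqVneq (bd b (enum_val a)) 0; first by rewrite scale0r mulr0.
have /cellsP[_ da] := enum_valP a.
by case/negP: bi; apply/cellsP; rewrite -db da.
Qed.

Lemma spread0 i b : spread (0 : 'rV[mp]_#|cells i|) b = 0.
Proof. by rewrite /spread big1 // => a _; rewrite mxE. Qed.

(** The nonfaces are the sets containing the label of a 0-cell, so the ideal is generated by the
    label monomials of the 0-cells. *)
Definition label_complex : {set {set 'I_n}} :=
  [set t : {set _} | [forall b in cells 0, ~~ (lab b \subset t)]].

Lemma label_complexPn (t : {set 'I_n}) :
  reflect (exists2 b, b \in cells 0 & lab b \subset t) (t \notin label_complex).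
Proof.
rewrite inE negb_forall; apply: (iffP existsP) => [[b]|[b b0 bt]].
  by rewrite negb_imply negbK => /andP[b0 bt]; exists b.
by exists b; rewrite negb_imply negbK b0.
Qed.

Lemma label_complex_simplicial : simplicial_complex label_complex.
Proof.
move=> s t sD ts; apply: contraLR sD => /label_complexPn[b b0 bt]; apply/label_complexPn.
by exists b => //; apply: subset_trans ts.
Qed.

Lemma label_ideal f : stanley_reisner label_complex f <->
  exists v : 'rV_#|cells 0|, v *m fr_aug label_resolution = f%:M.
Proof.
split=> [[q ->]|[v vf]].
  elim/big_rec: _ => [|s g /label_complexPn[b b0 bs] [v vg]].
    by exists 0; rewrite mul0mx; apply/matrixP=> x y; rewrite !ord1 !mxE eqxx mulr1n.
  exists (v + (q s * 'X_[mono (s :\: lab b)]) *: delta_mx 0 (enum_rank_in b0 b)).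
  rewrite mulmxDl vg -scalemxAl -rowE addrC raddfD /=; congr (_ + _).
  apply/matrixP=> x y; rewrite !ord1 !mxE eqxx mulr1n enum_rankK_in //.
  by rewrite -mulrA -mpolyXD -mono_setD // mono_prod.
have {vf} -> : f = \sum_a v 0 a * 'X_[mono (lab (enum_val a))].
  have := congr1 (fun M : 'M_1 => M 0 0) vf; rewrite !mxE eqxx mulr1n => <-.
  by apply: eq_bigr => a _; rewrite mxE.
(* Several 0-cells might share a label; their coefficients are added. *)
exists (fun s => \sum_(a | lab (enum_val a) == s) v 0 a).
rewrite (partition_big (fun a => lab (enum_val a)) (fun s => s \notin label_complex)) /=.
  apply: eq_bigr => s _; rewrite mulr_suml; apply: eq_bigr => a /eqP <-.
  by rewrite mono_prod.
by move=> a _; apply/label_complexPn; exists (enum_val a) => //; apply: enum_valP.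
Qed.

Lemma label_resolutionP :
  minimal_graded_free_resolution label_resolution (stanley_reisner label_complex).
Proof.
have mx0 (v : 'M[mp]_1) : v = 0 <-> v 0 0 = 0.
  by split=> [->|v0]; rewrite ?mxE //; apply/matrixP=> x y; rewrite !ord1 mxE.
split.
- split=> [a|i a b]; rewrite /= mxE; first by rewrite dhomogX; apply/eqP/mdeg_mono.
  have /cellsP[la da] := enum_valP a.
  have [->|bab _] := eqVneq (bd (enum_val a) (enum_val b)) 0; first by rewrite scale0r eqxx.
  have [_ _ sub lt] := bd_face la bab; split; first exact: ltnW.
  have -> : (#|lab (enum_val a)| - #|lab (enum_val b)| = #|lab (enum_val a) :\: lab (enum_val b)|)%N.
    by rewrite cardsD (setIidPr sub).
  by apply: dhomogZ; rewrite dhomogX; apply/eqP/mdeg_mono.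
- split=> [f|v|i v]; first exact: label_ideal.
  + split=> [va|[w <-]].
      apply: spread_lift; last by rewrite -mul_aug va mxE.
      (* A cell of dimension 0 has no facets, hence zero boundary. *)
      move=> y; rewrite /poly_bd big1 // => b _.
      have [/cellsP[lb db]|/spread_out ->] := boolP (b \in cells 0); last by rewrite mul0r.
      have [->|/(bd_face lb)[_]] := eqVneq (bd b y) 0; first by rewrite scale0r mulr0.
      by rewrite db.
    apply/mx0; rewrite mul_aug -(poly_bd_aug (spread_live w)).
    by apply: eq_bigr => b _; rewrite spread_diff.
  + split=> [vd|[w <-]].
      apply: spread_lift => [y|].
        by rewrite -spread_diff vd spread0.
      rewrite /poly_aug big1 // => b _.
      have [/cellsP[_ ->]|/spread_out ->] := boolP (b \in cells i.+1); last by rewrite mul0r.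
      by rewrite scale0r mulr0.
    apply/rowP=> a; rewrite mul_diff mxE -(poly_bdbd (enum_val a) (spread_live w)).
    by apply: poly_bd_eq; apply: spread_diff.
- move=> i a b; rewrite mxE mcoeffZ mcoeffX.
  have /cellsP[la da] := enum_valP a.
  have [->|bab] := eqVneq (bd (enum_val a) (enum_val b)) 0; first by rewrite mul0r.
  have [_ _ sub lt] := bd_face la bab.
  (* A constant term would force equal labels, but labels grow strictly. *)
  case: eqP => [m0|_]; last by rewrite mulr0.
  have := mdeg_mono (lab (enum_val a) :\: lab (enum_val b)).
  by rewrite m0 mdeg0 cardsD (setIidPr sub); lia.
Qed.
End Resolution.

(** * The simplicial complex for a given degree type *)

Theorem theorem4p7 (K : fieldType) (d : seq nat)
    (d_pos : forall x : nat, x \in d -> (0 < x)%N) :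
  exists (n : nat) (Delta : {set {set 'I_n}}) (beta : nat -> nat -> nat),
    [/\ simplicial_complex Delta,
        betti_diagram (@stanley_reisner K n Delta) beta,
        pure_diagram beta
      & has_degree_type beta d].
Proof.
(* [d] begins with d_p, so the reversal puts d_(j+1) at index [j]. *)
pose p := size d; pose e j := nth 0%N (rev d) j.
have e_gt0 j : (j < p)%N -> (0 < e j)%N.
  by move=> jp; apply: d_pos; rewrite -mem_rev mem_nth // size_rev.
have [c [C [gC ce]]] := realizable_all K e_gt0.
(* Labels are moved to ordinals along the enumeration of the variables. *)
pose L (b : cell C) : {set 'I_#|var C|} := [set k | enum_val k \in lab b].
have LE b : lab b = enum_val @: L b.
  apply/setP=> v; apply/idP/imsetP => [vb|[k kb ->]]; last by rewrite inE in kb.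
  by exists (enum_rank v); rewrite ?inE enum_rankK.
have cardL b : b \in @live K C -> #|L b| = c (dm b).
  by move=> /(rc_card gC) <-; rewrite LE card_imset //; apply: enum_val_inj.
have L_sub b (W : {set 'I_#|var C|}) : (L b \subset W) = (lab b \subset enum_val @: W).
  rewrite LE; apply/idP/idP => [|/subsetP LW]; first exact: imsetS.
  by apply/subsetP=> k kb; have /imsetP[l lW /enum_val_inj->] := LW _ (imset_f enum_val kb).
have bd_face b y : b \in @live K C -> @bd K C b y != 0 ->
    [/\ y \in @live K C, (dm y).+1 = dm b, L y \subset L b & (#|L y| < #|L b|)%N].
  move=> lb /(rc_bd gC lb)/and4P[ly /eqP dy sub _]; split=> //.
    by rewrite L_sub -LE.
  have yp : (dm y < p)%N by rewrite dy (rc_le gC lb).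
  by rewrite !cardL // -dy ce // -addn1 leq_add2l e_gt0.
have acyclic (W : {set 'I_#|var C|}) : (exists2 b, b \in @live K C & L b \subset W) ->
    exact_on (@bd K C) (@dm K C) [pred b | (b \in @live K C) && (L b \subset W)].
  case=> b lb; rewrite L_sub => bW.
  have res := rc_res gC (ex_intro2 _ _ b lb bW).
  by apply: eq_exact_on res => x; rewrite !inE L_sub.
pose F := label_resolution (@live K C) (@dm K C) L (@bd K C).
pose beta i j := #|[set a : 'I_(fr_rank F i) | fr_deg a == j]|.
have degF i (a : 'I_(fr_rank F i)) : [/\ fr_deg a = c i & (i <= p)%N].
  have /cellsP[la da] := enum_valP a; split; first by rewrite /= cardL ?da.
  by rewrite -da (rc_le gC la).
(* Purity: all cells of dimension [i] have labels of the same size [c i]. *)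
have betaN0 i j : beta i j <> 0%N -> c i = j /\ (i <= p)%N.
  move=> /eqP; rewrite cards_eq0 => /set0Pn[a]; rewrite inE.
  by have [-> ip] := degF i a => /eqP.
exists #|var C|, (label_complex (@live K C) (@dm K C) L), beta; split.
- exact: label_complex_simplicial.
- exists F => //; apply: label_resolutionP bd_face _ _ acyclic; first exact: rc_bdbd gC.
  exact: rc_aug gC.
- by move=> i j j' /betaN0[<- _] /betaN0[<- _].
- exists p, c; split=> [i ip|i j pi|].
  + have [b lb db] := rc_ex gC ip.
    have bi : b \in cells (@live K C) (@dm K C) i by apply/cellsP.
    apply/eqP; rewrite cards_eq0; apply/set0Pn; exists (enum_rank_in bi b : 'I_(fr_rank F i)).
    by rewrite inE; have [-> _] := degF i (enum_rank_in bi b).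
  + by apply/eqP/negPn/negP => /eqP/betaN0[_]; rewrite leqNgt pi.
  + rewrite (_ : mkseq _ p = rev d) ?revK // -[RHS](mkseq_nth 0%N) size_rev.
    apply/eq_in_map => j; rewrite mem_iota /= => jp.
    by rewrite ce // addKn.
Qed.
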